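(* Let $k, r, \delta$ be integers with $r\ge 2$, $\delta\ge 2$ and $r<k$. For any $[n,k,d]_q$ linear code with information $(r,\delta)_c$-locality, $$n \ge d+k-1+\mu, \qquad\text{where } \mu = \left\lceil \frac{(k-1)(\delta-1)+1}{(r-1)(\delta-1)+1}\right\rceil -1 .$$
   Context: An $[n,k,d]_q$ linear code is a $k$-dimensional linear subspace $\mathcal{C}\subseteq\mathbb{F}_q^n$ with minimum (Hamming) distance $d$. Let $G=(g_1,\dots,g_n)$ be a $k\times n$ generator matrix of $\mathcal{C}$, with columns $g_i\in\mathbb{F}_q^k$, so that $\mathcal{C}=\{x^\tau G: x\in\mathbb{F}_q^k\}$. Write $[n]=\{1,\dots,n\}$; for $N\subseteq[n]$ let $\operatorname{span}(N)$ be the $\mathbb{F}_q$-linear span of $\{g_i: i\in N\}$ and $\operatorname{rank}(N)$ its dimension. A set $I\subseteq[n]$ is an information set if $|I|=\operatorname{rank}(I)=k$. The $i$-th coordinate of $\mathcal{C}$ has $(r,\delta)_c$-locality if there exist $\delta-1$ pairwise disjoint sets $R^{(i)}_1,\dots,R^{(i)}_{\delta-1}\subseteq[n]\setminus\{i\}$ such that for every $1\le\xi\le\delta-1$: $|R^{(i)}_\xi|\le r$ and $g_i\in\operatorname{span}(R^{(i)}_\xi)$. (This does not depend on the choice of $G$.) The code $\mathcal{C}$ has information $(r,\delta)_c$-locality if there is an information set $I$ such that every coordinate $i\in I$ has $(r,\delta)_c$-locality. *)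

(* Defs.v *)
(* Mathematical Components *)
From mathcomp Require Import all_boot all_order all_algebra.
Set Implicit Arguments.
Unset Strict Implicit.
Unset Printing Implicit Defensive.
Import Order.TTheory GRing.Theory Num.Theory.
Local Open Scope ring_scope.

Section Codes.
Variables (F : finFieldType) (n : nat).
Implicit Types (C : {vspace 'rV[F]_n}) (x y : 'rV[F]_n).

Definition hamming_dist x y : nat := #|[set i : 'I_n | x 0 i != y 0 i]|.

Definition min_distance C (d : nat) : Prop :=
  (exists x y, [/\ x \in C, y \in C, x != y & hamming_dist x y = d]) /\
  (forall x y, x \in C -> y \in C -> x != y -> (d <= hamming_dist x y)%N).

Definition linear_code (k d : nat) C : Prop := \dim C = k /\ min_distance C d.

(* When \dim C = k, this forces the k rows of G to be linearly independent. *)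
Definition generator_matrix (k : nat) (G : 'M[F]_(k, n)) C : Prop :=
  forall c : 'rV[F]_n, c \in C <-> exists x : 'cV[F]_k, c = x^T *m G.

Section Locality.
Variables (k : nat) (G : 'M[F]_(k, n)).

Definition col_span (N : {set 'I_n}) : {vspace 'cV[F]_k} :=
  <<[seq col i G | i in N]>>%VS.

Definition col_rank (N : {set 'I_n}) : nat := \dim (col_span N).

Definition information_set (I : {set 'I_n}) : Prop :=
  #|I| = k /\ col_rank I = k.

(* The repair sets form an indexed family, so they are counted with
   multiplicity (this matters only for empty sets, i.e. when col i G = 0). *)
Definition coord_locality (r delta : nat) (i : 'I_n) : Prop :=
  exists R : 'I_(delta - 1) -> {set 'I_n},
    (forall xi eta, xi != eta -> [disjoint R xi & R eta]) /\
    (forall xi, [/\ i \notin R xi, (#|R xi| <= r)%N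
                  & col i G \in col_span (R xi)]).

Definition information_locality (r delta : nat) : Prop :=
  exists I : {set 'I_n},
    information_set I /\ forall i, i \in I -> coord_locality r delta i.

End Locality.
End Codes.

Definition mu (k r delta : nat) : int :=
  Num.ceil (((k%:R - 1) * (delta%:R - 1) + 1)
            / ((r%:R - 1) * (delta%:R - 1) + 1) : rat) - 1.

(* Main.v *)
(* A nonzero codeword vanishes on every set N of coordinates of rank less than
   k, so d <= n - |N|, and it suffices to find N of rank k - 1 and nullity
   |N| - rank N at least mu.  If g_i is not in span(N), then adding to N the
   coordinate i together with s of its repair sets increases the rank by at
   most 1 + s (r - 1) and the nullity by at least s: each repair set brings a
   dependency involving i which is not already visible in N.  Since mu is at
   most m = floor ((k-1)(delta-1) / ((r-1)(delta-1)+1)), and since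
   m <= (k - 1 - m (r - 1)) (delta - 1), at most k - 1 - m (r - 1) such steps
   suffice to reach nullity m with rank at most k - 1. *)
Require Import Defs.
From mathcomp Require Import all_boot all_order all_algebra.
From mathcomp Require Import zify.
Import Order.TTheory GRing.Theory Num.Theory.
Local Open Scope ring_scope.

Set Implicit Arguments.
Unset Strict Implicit.
Unset Printing Implicit Defensive.

(** * Rank and nullity of finite subfamilies of vectors *)

Section SpanOfFamily.
Variables (K : fieldType) (V : vectType K) (T : finType) (v : T -> V).
Implicit Types (A B M N R : {set T}) (i : T).

(** For [v := fun i => col i G] this is convertible to [col_span G], so facts pass between the two
    without rewriting. *)
Definition fspan A : {vspace V} := <<[seq v i | i in A]>>%VS.
Definition frank A : nat := \dim (fspan A).

Lemma mem_fspan A i : i \in A -> v i \in fspan A.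
Proof. by move=> iA; apply/memv_span/image_f. Qed.

Lemma fspan_subv A (U : {vspace V}) :
  (forall i, i \in A -> v i \in U) -> (fspan A <= U)%VS.
Proof. by move=> sAU; apply/span_subvP => _ /imageP[i iA ->]; apply: sAU. Qed.

Lemma fspanS A B : A \subset B -> (fspan A <= fspan B)%VS.
Proof. by move=> /subsetP sAB; apply: fspan_subv => i /sAB/mem_fspan. Qed.

Lemma fspanU A B : fspan (A :|: B) = (fspan A + fspan B)%VS.
Proof.
apply/eqP; rewrite eqEsubv subv_add !fspanS ?subsetUl ?subsetUr // !andbT.
apply: fspan_subv => i /setUP[] /mem_fspan; apply/subvP.
  exact: addvSl.
exact: addvSr.
Qed.

Lemma frank_leq_card A : (frank A <= #|A|)%N.
Proof. by rewrite /frank (leq_trans (dim_span _)) // size_image. Qed.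

Lemma frankU A B : (frank (A :|: B) <= frank A + #|B|)%N.
Proof.
rewrite /frank fspanU (leq_trans (dimv_add_leqif _ _)) //.
by rewrite leq_add2l frank_leq_card.
Qed.

(** Write [v i = a + b] with [a] in the span of [R :&: M] and [b] in that of [R :\: M]. Then
    [b = v i - a] lies in [fspan M], and it is nonzero because [a] is in [fspan N] while [v i] is
    not. The two spans thus meet nontrivially, which costs at least one dimension. *)
Lemma frank_add_repair_set M N R i :
    N \subset M -> i \in M -> v i \notin fspan N ->
    v i \in fspan R -> R :&: M \subset N ->
  (frank (M :|: R) < frank M + #|R :\: M|)%N.
Proof.
move=> sNM iM iN iR sRN.
have -> : M :|: R = M :|: R :\: M.
  by rewrite setDE setUIr setUCr setIT.
rewrite /frank fspanU.
have := dimv_sum_cap (fspan M) (fspan (R :\: M)).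
have : (0 < \dim (fspan M :&: fspan (R :\: M)))%N.
  rewrite lt0n dimv_eq0; apply/eqP => cap0.
  move: iR; rewrite -(setID R M) fspanU => /memv_addP[a aRM [b bD def_vi]].
  have aN : a \in fspan N by apply: subvP aRM; apply: fspanS.
  have : b \in (fspan M :&: fspan (R :\: M))%VS.
    rewrite memv_cap bD andbT.
    have -> : b = v i - a by rewrite def_vi addrC addKr.
    by rewrite memvB ?mem_fspan // (subvP (fspanS sNM)).
  rewrite cap0 memv0 => /eqP b0.
  by move: iN; rewrite def_vi b0 addr0 aN.
have := frank_leq_card (R :\: M); rewrite /frank.
lia.
Qed.

(** [M] is [N] with [i] and the sets [R x], [x] in [L], adjoined one by one; each [R x] brings at
    most [r] new elements, at least one of them redundant for the rank. *)
Lemma frank_add_repair_family N i (r : nat) (J : eqType) (R : J -> {set T})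
    (L : seq J) :
    v i \notin fspan N ->
    (forall x y, x != y -> [disjoint R x & R y]) ->
    (forall x, [/\ i \notin R x, (#|R x| <= r)%N & v i \in fspan (R x)]) ->
    uniq L ->
  exists M : {set T},
    (frank M <= frank N + 1 + size L * (r - 1))%N /\
    (frank M + size L + #|N| <= #|M| + frank N)%N.
Proof.
move=> iN disjR propR.
suff IH : uniq L -> let M := i |: N :|: \bigcup_(x <- L) R x in
    (frank M <= frank N + 1 + size L * (r - 1))%N /\
    (frank M + size L + #|N| <= #|M| + frank N)%N.
  by move=> /IH; exists (i |: N :|: \bigcup_(x <- L) R x).
elim: L => [|x L IHL] /=.
  have := frankU N [set i]; rewrite big_nil setU0 [N :|: _]setUC cards1 cardsU1.
  have -> : i \notin N by apply: contra iN; apply: mem_fspan.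
  lia.
case/andP=> xL /IHL[]; rewrite big_cons.
set M := i |: N :|: \bigcup_(y <- L) R y => rkM nulM.
have [iRx cRx viRx] := propR x.
have -> : i |: N :|: (R x :|: \bigcup_(y <- L) R y) = M :|: R x.
  by rewrite setUA setUAC.
have sNM : N \subset M by apply: subset_trans (subsetUl _ _); apply: subsetUr.
have iM : i \in M by rewrite !inE eqxx.
have sRN : R x :&: M \subset N.
  apply/subsetP => j /setIP[jRx]; rewrite !inE -orbA.
  case/or3P => [/eqP ji|//|].
    by rewrite -ji jRx in iRx.
  (* An element of [R x] cannot come from an earlier [R y]: [x] is not in [L], so the two sets are
     disjoint. *)
  elim: (L) xL => [|y L' IHL']; first by rewrite big_nil inE.
  rewrite big_cons !inE negb_or => /andP[xy xL'] /orP[jRy|/IHL'-> //].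
  by have /disjointFr/(_ jRx) := disjR _ _ xy; rewrite jRy.
have := frank_add_repair_set sNM iM iN viRx sRN.
have -> : #|M :|: R x| = (#|M| + #|R x :\: M|)%N.
  have := cardsUI M (R x); have := cardsID M (R x).
  by rewrite [R x :&: M]setIC; lia.
have : (#|R x :\: M| <= r)%N.
  by apply: leq_trans cRx; apply/subset_leq_card/subsetDl.
rewrite mulSn.
lia.
Qed.

Lemma fspan_outside A N :
  (frank N < frank A)%N -> exists2 i, i \in A & v i \notin fspan N.
Proof.
move=> ltNA; apply/exists_inP; rewrite -[X in is_true X]negbK negb_exists_in.
apply/forall_inP => sAN; move: ltNA; rewrite ltnNge dimvS //.
by apply: fspan_subv => i /sAN; rewrite negbK.
Qed.

(** In the bound [e + m * (r - 1)], [e] pays for the coordinates adjoined, one per step, and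
    [m * (r - 1)] for the repair sets. *)
Lemma exists_frank_nullity A (r t m e : nat) :
    (forall i, i \in A -> exists R : 'I_t -> {set T},
      (forall x y, x != y -> [disjoint R x & R y]) /\
      (forall x, [/\ i \notin R x, (#|R x| <= r)%N & v i \in fspan (R x)])) ->
    (m <= e * t)%N -> (e + m * (r - 1) < frank A)%N ->
  exists N : {set T},
    (frank N <= e + m * (r - 1))%N /\ (frank N + m <= #|N|)%N.
Proof.
move=> locA; elim: e m => [|e IHe] m le_m ltA.
  have -> : m = 0%N by lia.
  exists set0; have := frank_leq_card set0; rewrite cards0; lia.
(* All [t] repair sets are used unless fewer dependencies are missing; either way
   [m - s <= e * t]. *)
pose s := minn m t.
have [||N [rkN nulN]] := IHe (m - s)%N; [by lia | by nia |].
have [|i iA iN] := @fspan_outside A N; first by nia.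
have [R [disjR propR]] := locA i iA.
have [|M] := frank_add_repair_family (L := take s (enum 'I_t)) iN disjR propR.
  by rewrite take_uniq ?enum_uniq.
rewrite size_takel ?size_enum_ord ?geq_minr // => -[rkM nulM].
exists M; split; last by lia.
have -> : m = (m - s + s)%N by lia.
by rewrite mulnDl; lia.
Qed.

(** Adjoining a vector outside the span raises rank and cardinality by one each, so the nullity is
    kept. *)
Lemma exists_extension_frank A N (e : nat) :
    (frank N <= e)%N -> (e < frank A)%N ->
  exists M : {set T}, frank M = e /\ (e + #|N| <= #|M| + frank N)%N.
Proof.
move def_x: (e - frank N)%N => x; elim: x N def_x => [|x IHx] N def_x leN ltA.
  by exists N; lia.
have [|i iA iN] := @fspan_outside A N; first by lia.
have inN : i \notin N by apply: contra iN; apply: mem_fspan.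
have rkiN : frank (i |: N) = (frank N).+1.
  apply/eqP; rewrite eqn_leq; apply/andP; split.
    by rewrite setUC -addn1 -(cards1 i) frankU.
  rewrite ltnNge; apply: contra iN => leiN.
  have /eqP -> : fspan N == fspan (i |: N).
    by rewrite eqEdim fspanS ?subsetUr.
  by rewrite mem_fspan // setU11.
have [|||M [rkM nulM]] := IHx (i |: N); try lia.
by exists M; move: nulM; rewrite cardsU1 inN; lia.
Qed.

End SpanOfFamily.

(** * Minimum distance and sets of coordinates of small rank *)

Lemma exists_annihilator (K : fieldType) (k : nat) (U : {vspace 'cV[K]_k}) :
    (\dim U < k)%N ->
  exists2 u : 'rV[K]_k, u != 0 & forall w, w \in U -> u *m w = 0.
Proof.
move=> ltUk.
pose B := \matrix_(a < k, b < \dim U) (vbasis U)`_b a 0.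
have : kermx B != 0.
  rewrite -mxrank_eq0 mxrank_ker -lt0n subn_gt0.
  exact: leq_ltn_trans (rank_leq_col B) ltUk.
case/rowV0Pn => u /sub_kermxP uB u0; exists u => // w /coord_vbasis ->.
rewrite mulmx_sumr big1 // => b _; rewrite -scalemxAr.
suff -> : u *m (vbasis U)`_b = 0 by rewrite scaler0.
have -> : (vbasis U)`_b = col b B.
  by apply/matrixP => a c; rewrite !mxE ord1.
by rewrite colE mulmxA uB mul0mx.
Qed.

Section Codes.
Variables (F : finFieldType) (n k d : nat).
Variables (C : {vspace 'rV[F]_n}) (G : 'M[F]_(k, n)).
Hypotheses (codeC : linear_code k d C) (genG : generator_matrix G C).

Lemma generator_matrix_mem (u : 'rV[F]_k) : u *m G \in C.
Proof. by apply/genG; exists u^T; rewrite trmxK. Qed.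

Lemma generator_matrix_inj (u : 'rV[F]_k) : u *m G = 0 -> u = 0.
Proof.
move=> uG0; pose f := linfun (mulmxr G : 'rV[F]_k -> 'rV[F]_n).
have limgE : limg f = C.
  apply/vspaceP => c; apply/memv_imgP/idP => [[w _ ->]|].
    by rewrite lfunE /= generator_matrix_mem.
  by move/genG => [x ->]; exists x^T; rewrite ?memvf // lfunE.
(* Rank-nullity: [f] maps a space of dimension [k] onto [C], also of dimension [k]. *)
have := limg_ker_dim f fullv; rewrite limgE codeC.1 dimvf /dim /= mul1n capfv.
move=> dim_ker; have /eqP : \dim (lker f) = 0%N by lia.
rewrite dimv_eq0 => /eqP ker0; apply/eqP; rewrite -memv0 -ker0 memv_ker.
by rewrite lfunE /= uG0.
Qed.

Lemma min_distance_leq_corank (N : {set 'I_n}) :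
  (col_rank G N < k)%N -> (d + #|N| <= n)%N.
Proof.
move=> /exists_annihilator[u u0 uN].
have uG0 : u *m G != 0 by apply: contra u0 => /eqP/generator_matrix_inj->.
have := codeC.2.2 _ _ (generator_matrix_mem u) (mem0v C) uG0.
rewrite /hamming_dist; set D := [set _ | _] => le_dD.
have sDN : D \subset ~: N.
  apply/subsetP => i; rewrite !inE; apply: contra => iN.
  have /matrixP/(_ 0 0) : u *m col i G = 0 by apply/uN/memv_span/image_f.
  by rewrite colE mulmxA -colE !mxE => ->.
apply: (@leq_trans (#|~: N| + #|N|)); last by rewrite addnC cardsC card_ord.
by rewrite leq_add2r (leq_trans le_dD) ?subset_leq_card.
Qed.

End Codes.

(** * The numerical bound and the conclusion *)

Lemma mu_leq (k r delta : nat) : (0 < k)%N -> (0 < r)%N -> (0 < delta)%N ->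
  mu k r delta
    <= (((k - 1) * (delta - 1)) %/ ((r - 1) * (delta - 1) + 1))%N%:Z.
Proof.
move=> k_gt0 r_gt0 delta_gt0; rewrite /mu.
set B := ((r - 1) * (delta - 1) + 1)%N; set A := ((k - 1) * (delta - 1))%N.
have -> : (k%:R - 1) * (delta%:R - 1) + 1 = (A + 1)%:R :> rat.
  by rewrite natrD natrM !natrB.
have -> : (r%:R - 1) * (delta%:R - 1) + 1 = B%:R :> rat.
  by rewrite natrD natrM !natrB.
(* What remains is [A + 1 <= (A %/ B + 1) * B], that is, [A] lies strictly below the next multiple
   of [B]. *)
rewrite lerBlDr ceil_le_int ler_pdivrMr ?ltr0n /B ?addn1 //.
by rewrite -PoszD -pmulrn -natrM ler_nat addn1 ltn_ceil.
Qed.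

Theorem theorem1 (F : finFieldType) (n k d r delta : nat)
    (C : {vspace 'rV[F]_n}) (G : 'M[F]_(k, n))
    (r_ge2 : (2 <= r)%N) (delta_ge2 : (2 <= delta)%N) (r_lt_k : (r < k)%N)
    (codeC : linear_code k d C) (genG : generator_matrix G C)
    (locC : information_locality G r delta) :
  d%:Z + k%:Z - 1 + mu k r delta <= n%:Z.
Proof.
have [I [[_ rkI] locI]] := locC.
have frankI : frank (fun i => col i G) I = k := rkI.
have k_gt0 : (0 < k)%N by lia.
have : mu k r delta <= _ := mu_leq k_gt0 (ltnW r_ge2) (ltnW delta_ge2).
set m := (_ %/ _)%N => le_mu.
have le_m : (m * ((r - 1) * (delta - 1) + 1) <= (k - 1) * (delta - 1))%N.
  exact: leq_divM.
(* Cancel [delta - 1 >= 1] in [le_m]. This makes the truncated subtraction in [e] exact, so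
   [e + m * (r - 1) = k - 1]. *)
have le_mk : (m * (r - 1) <= k - 1)%N by nia.
pose e := (k - 1 - m * (r - 1))%N.
have [||N [rkN nulN]] :=
  exists_frank_nullity (v := fun i => col i G) (m := m) (e := e) locI.
- by rewrite /e; nia.
- by rewrite frankI /e; lia.
have [||M [rkM nulM]] :=
  exists_extension_frank (v := fun i => col i G) (A := I) (N := N)
    (e := (k - 1)%N).
- by rewrite /e in rkN; lia.
- by rewrite frankI; lia.
have : (d + #|M| <= n)%N.
  apply: (min_distance_leq_corank codeC genG).
  by rewrite -[col_rank G M]/(frank _ M) rkM; lia.
lia.
Qed.
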